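(* Let $\delta\in\mathbb{R}$. The sequence $\langle n^\delta\mid n\in\mathbb{N}^+\rangle$ is dense-expandable if and only if either $\delta=-1$, or $\delta>-1$ and $\delta\notin\mathbb{Z}$.
   Context: $\mathbb{N}^+$ denotes the positive integers. A sequence $\langle A(n)\rangle$ of positive reals (indexed by a set of integers) is dense-expandable if the set of all finite signed sums $\{\sum_{n\in S}\varepsilon_n A(n) : S \text{ a finite subset of the index set},\ \varepsilon_n\in\{-1,1\}\}$ is dense in $\mathbb{R}$. *)

(* Defs.v *)
From HB Require Import structures.
From mathcomp Require Import all_boot all_order all_algebra finmap.
From mathcomp Require Import all_classical all_reals all_analysis.

Set Implicit Arguments.
Unset Strict Implicit.
Unset Printing Implicit Defensive.

Import Order.TTheory GRing.Theory Num.Theory.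
Import numFieldNormedType.Exports.

Local Open Scope classical_set_scope.
Local Open Scope ring_scope.

(* The sequence is the restriction of A to the index set I; the signs outside
   the finite set S are irrelevant. *)
Definition signed_sums (R : realType) (T : choiceType) (I : set T)
    (A : T -> R) : set R :=
  [set x | exists (S : {fset T}) (eps : T -> R),
     [/\ [set` S] `<=` I,
         forall n, n \in S -> eps n = -1 \/ eps n = 1 &
         x = \sum_(n <- S) eps n * A n]].

Definition dense_expandable (R : realType) (T : choiceType) (I : set T)
    (A : T -> R) : Prop :=
  dense (signed_sums I A).

(* Main.v *)
(* Write k for the ceiling of delta (k = 0 if delta = -1). The iterated
   difference of x^delta with steps 1, 2, ..., 2^(k-1) is a signed sum over a
   block of 2^k consecutive integers, with Thue-Morse signs, and by the mean
   value theorem it equals C * xi^(delta - k) with xi in that block and C <> 0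
   when delta is not an integer. As -1 <= delta - k < 0, the absolute values of
   these sums over successive blocks tend to 0 and dominate a multiple of the
   harmonic series, so a sum of consecutive ones, starting far enough,
   approximates any nonnegative real. Conversely the signed sums are bounded if
   delta < -1, and integers if delta is a nonnegative integer. *)
Require Import Defs.
From HB Require Import structures.
From mathcomp Require Import all_boot all_order all_algebra finmap.
From mathcomp Require Import all_classical all_reals all_analysis.
From mathcomp Require Import zify ring lra.

Set Implicit Arguments.
Unset Strict Implicit.
Unset Printing Implicit Defensive.

Import Order.TTheory GRing.Theory Num.Theory.
Import numFieldNormedType.Exports.

Local Open Scope classical_set_scope.
Local Open Scope ring_scope.

(** * Signed sums over intervals of integers *)

(** Every index of the interval carries a sign, so sums over adjacent intervals share no index and
    concatenate into one. *)
Definition signed_interval_sum (R : realType) (A : nat -> R) (l u : nat)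
    (x : R) : Prop :=
  exists2 eps : nat -> R, (forall n, eps n = -1 \/ eps n = 1) &
    x = \sum_(l <= n < u) eps n * A n.

Lemma signed_interval_sum1 (R : realType) (A : nat -> R) (n : nat) :
  signed_interval_sum A n n.+1 (A n).
Proof. by exists (fun=> 1); [right|rewrite big_nat1 mul1r]. Qed.

Lemma signed_interval_sumN (R : realType) (A : nat -> R) l u x :
  signed_interval_sum A l u x -> signed_interval_sum A l u (- x).
Proof.
case=> eps epsE ->; exists (fun n => - eps n).
  by move=> n; case: (epsE n) => ->; rewrite ?opprK; [right|left].
by rewrite -sumrN; apply: eq_bigr => n _; rewrite mulNr.
Qed.

Lemma signed_interval_sumD (R : realType) (A : nat -> R) l m u x y :
  (l <= m)%N -> (m <= u)%N ->
  signed_interval_sum A l m x -> signed_interval_sum A m u y ->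
  signed_interval_sum A l u (x + y).
Proof.
move=> lm mu [e eE ->] [f fE ->].
exists (fun n => if (n < m)%N then e n else f n).
  by move=> n; case: ifP.
rewrite [RHS](@big_cat_nat _ _ _ m) //=; congr (_ + _); apply: eq_big_nat => n.
  by case/andP=> _ ->.
by case/andP=> mn _; rewrite ltnNge mn.
Qed.

Lemma signed_interval_sum_in (R : realType) (A : nat -> R) l u x :
  (0 < l)%N -> signed_interval_sum A l u x ->
  signed_sums [set n : nat | (0 < n)%N] A x.
Proof.
move=> l0 [eps epsE ->].
exists [fset n in index_iota l u]%fset, eps; split => //.
  move=> n /=; rewrite !inE /= mem_index_iota => /andP[ln _].
  exact: leq_trans ln.
apply: perm_big; apply: uniq_perm; rewrite ?iota_uniq ?fset_uniq //.
by move=> n; rewrite !inE.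
Qed.

(** * Density from vanishing block sums with divergent series *)

(** Start at an [M] past which all terms are below [e], and stop just before the partial sums first
    exceed [y]: the error is at most the next term. *)
Lemma tail_sum_approx (R : realType) (b : R^nat) (y e : R) :
  (forall n, 0 <= b n) -> b @ \oo --> 0 -> ~ cvgn (series b) ->
  0 <= y -> 0 < e ->
  exists M N, (M <= N)%N /\ `|y - \sum_(M <= m < N) b m| < e.
Proof.
move=> b0 bcvg bdvg y0 e0.
have /cvgr0Pnorm_lt/(_ e e0)[M _ bM] := bcvg.
have /cvgryPgt/(_ (y + series b M)) [N _ bN] : series b @ \oo --> +oo%R.
  apply: nondecreasing_dvgn_lt => //.
  by apply: nondecreasing_series => n _ _; exact: b0.
have exN : exists n, y < \sum_(M <= m < M + n) b m.
  exists N; have := bN (M + N)%N (leq_addl _ _).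
  by rewrite /series /= (@big_cat_nat _ _ _ M 0 (M + N)) ?leq_addr //=; lra.
case: (ex_minnP exN) => -[|n]; first by rewrite addn0 big_geq // ltNge y0.
rewrite addnS big_nat_recr ?leq_addr //= => yS minS.
have Sy : \sum_(M <= m < M + n) b m <= y.
  by rewrite leNgt; apply/negP => /minS; rewrite ltnn.
exists M, (M + n)%N; split; first exact: leq_addr.
have := bM (M + n)%N (leq_addr _ _).
rewrite !ger0_norm ?subr_ge0 //; lra.
Qed.

Lemma dense_of_blocks (R : realType) (A : nat -> R) (p : nat -> nat)
    (b : R^nat) :
  (forall m, 0 < p m)%N -> {homo p : m n / (m <= n)%N} ->
  (forall m, signed_interval_sum A (p m) (p m.+1) (b m)) ->
  (forall m, 0 <= b m) -> b @ \oo --> 0 -> ~ cvgn (series b) ->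
  dense_expandable [set n : nat | (0 < n)%N] A.
Proof.
move=> p0 pm bA b0 bcvg bdvg O [y Oy] openO.
have /nbhs_ballP[e /= e0 yeO] := open_nbhs_nbhs (conj openO Oy).
have [M [N [MN MNe]]] := tail_sum_approx b0 bcvg bdvg (normr_ge0 y) e0.
have SA : signed_interval_sum A (p M) (p N) (\sum_(M <= m < N) b m).
  elim: N MN {MNe} => [|N IH].
    by rewrite leqn0 => /eqP ->; rewrite big_geq //; exists (fun=> 1);
      [right|rewrite big_geq].
  rewrite leq_eqVlt => /orP[/eqP ->|].
    by rewrite big_geq //; exists (fun=> 1); [right|rewrite big_geq].
  rewrite ltnS => MN; rewrite big_nat_recr //=.
  by apply: (signed_interval_sumD (m := p N)); rewrite ?pm //; exact: IH.
(* The sum approximates [|y|]; for negative [y], flip all its signs. *)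
have [y0|y0] := leP 0 y.
  exists (\sum_(M <= m < N) b m); split; last exact: signed_interval_sum_in SA.
  by apply: yeO; rewrite /ball /= -{1}(ger0_norm y0).
exists (- \sum_(M <= m < N) b m); split.
  apply: yeO; rewrite /ball /= opprK -normrN opprD -{1}(ltr0_norm y0) //.
exact: signed_interval_sum_in (signed_interval_sumN SA).
Qed.

(** * Iterated differences of a power *)

(* Doubling the step at each stage makes the two shifted blocks adjacent, so
   that every integer of the block of length 2^k is used exactly once. *)
Fixpoint dyadic_diff (R : realType) (k : nat) (d x : R) : R :=
  if k is j.+1 then dyadic_diff j d (x + 2 ^+ j) - dyadic_diff j d x
  else x `^ d.

(** In closed form, 2^(k(k-1)/2) * d(d-1)...(d-k+1). *)
Fixpoint dyadic_coef (R : realType) (k : nat) (d : R) : R :=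
  if k is j.+1 then 2 ^+ j * d * dyadic_coef j (d - 1) else 1.

Lemma dyadic_coef_neq0 (R : realType) k (d : R) :
  d \isn't a Num.int -> dyadic_coef k d != 0.
Proof.
elim: k d => [|k IH] d dint /=; first exact: oner_neq0.
rewrite !mulf_neq0 ?expf_neq0 ?pnatr_eq0 //.
  by apply: contraNneq dint => ->; rewrite rpred0.
by apply: IH; rewrite rpredBr ?rpred1.
Qed.

Lemma signed_interval_dyadic_diff (R : realType) k (d : R) n :
  signed_interval_sum (fun n => n%:R `^ d) n (n + 2 ^ k)
    (dyadic_diff k d n%:R).
Proof.
elim: k n => [|k IH] n /=; first by rewrite addn1; exact: signed_interval_sum1.
rewrite addrC expnS mul2n -addnn addnA.
apply: (signed_interval_sumD (m := n + 2 ^ k)); rewrite ?leq_addr //.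
  exact: signed_interval_sumN.
by rewrite -natrX -natrD.
Qed.

Lemma is_derive_dyadic_diff (R : realType) k (d x : R) : 0 < x ->
  is_derive x 1 (dyadic_diff k d) (d * dyadic_diff k (d - 1) x).
Proof.
elim: k x => [|k IH] x x0 /=; first exact: is_derive1_powR.
rewrite mulrBr; apply: is_deriveB; last exact: IH.
have := IH (x + 2 ^+ k) (addr_gt0 x0 (exprn_gt0 k (ltr0Sn R 1))) => H.
have shift1 : is_derive x 1 (fun y : R => y + 2 ^+ k) 1.
  by apply: is_derive_eq; rewrite addr0.
have := @is_derive1_comp _ _ (fun y : R => y + 2 ^+ k) _ _ _ H shift1.
by rewrite mulr1.
Qed.

(** The mean value theorem turns the outermost difference, of step 2^j, into 2^j * d times the
    remaining differences of x^(d-1) at an intermediate point, to which induction applies. *)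
Lemma dyadic_diff_mean_value (R : realType) k (d x : R) : 0 < x ->
  exists2 xi, x <= xi <= x + 2 ^+ k &
    dyadic_diff k d x = dyadic_coef k d * xi `^ (d - k%:R).
Proof.
elim: k d x => [|k IH] d x x0 /=.
  by exists x; rewrite ?lexx ?lerDl ?ler01 // subr0 mul1r.
have pk : 0 < 2 ^+ k :> R by rewrite exprn_gt0.
have [|c||c] := @MVT R (dyadic_diff k d)
  (fun x => d * dyadic_diff k (d - 1) x) x (x + 2 ^+ k).
- by rewrite ltrDl.
- rewrite in_itv /= => /andP[xc _]; apply: is_derive_dyadic_diff.
  exact: lt_trans xc.
- apply: derivable_within_continuous => c; rewrite in_itv /= => /andP[xc _].
  have := is_derive_dyadic_diff k d (lt_le_trans x0 xc).
  by case.
rewrite in_itv /= => /andP[xc cx] ->.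
have [xi /andP[cxi xic] ->] := IH (d - 1) c (lt_trans x0 xc).
exists xi.
  by rewrite exprS; apply/andP; split; lra.
rewrite -(natr1 k).
have -> : d - 1 - k%:R = d - (k%:R + 1) by ring.
by ring.
Qed.

Lemma powR_seq_cvg0 (R : realType) (a : R) : a < 0 ->
  (fun n : nat => n.+1%:R `^ a) @ \oo --> 0.
Proof.
move=> a0.
have -> : (fun n : nat => n.+1%:R `^ a) = (fun n => harmonic n `^ (- a)).
  apply/funext => n.
  by rewrite /= -powR_inv1 // -powRrM mulrNN mul1r.
have /cvg_at_rightP : x `^ (- a) @[x --> (0 : R)^'+] --> 0.
  by apply: powR_cvg0; rewrite oppr_gt0.
apply; split; last exact: cvg_harmonic.
exact: harmonic_gt0.
Qed.

(** Asking for a nonzero coefficient, not for a non-integer [d], also covers [d = -1] with [k = 0],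
    where each block is a single term. *)
Lemma dense_expandable_powR (R : realType) k (d : R) :
  dyadic_coef k d != 0 -> -1 <= d - k%:R < 0 ->
  dense_expandable [set n : nat | (0 < n)%N] (fun n : nat => n%:R `^ d).
Proof.
move=> C0 /andP[a1 a0].
set C := dyadic_coef k d in C0; set a := d - k%:R in a1 a0.
pose b m : R := `|dyadic_diff k d (2 ^ k * m).+1%:R|.
have Cgt0 : 0 < `|C| by rewrite normr_gt0.
(* The mean value point [xi] lies between m+1 and 2^(k+1) * (m+1). The upper bound uses a < 0; the
   lower one uses xi^a >= xi^(-1), as xi >= 1 and a >= -1. *)
have bounds m :
    `|C| / 2 ^+ k.+1 * harmonic m <= b m <= `|C| * m.+1%:R `^ a.
  rewrite /b; have [xi /andP[xi1 xi2] ->] := dyadic_diff_mean_value k d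
    (ltr0Sn R (2 ^ k * m)).
  rewrite normrM (ger0_norm (powR_ge0 _ _)) -mulrA -/a.
  have pk : (0 < 2 ^ k)%N by rewrite expn_gt0.
  have lexi : m.+1%:R <= xi.
    by apply: le_trans xi1; rewrite ler_nat; nia.
  have xile : xi <= 2 ^+ k.+1 * m.+1%:R.
    apply: le_trans xi2 _; rewrite -!natrX -natrD -natrM ler_nat expnS; nia.
  have m0 : (0 : R) < m.+1%:R by [].
  have xi0 : 0 < xi by exact: lt_le_trans lexi.
  have xi_ge1 : 1 <= xi by apply: le_trans lexi; rewrite ler1n.
  rewrite !ler_pM2l //; apply/andP; split.
    apply: (@le_trans _ _ (xi `^ (-1))); last exact: ler_powR.
    by rewrite powR_inv1 ?(ltW xi0) // -invfM lef_pV2 ?posrE.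
  have -> : a = - (- a) by rewrite opprK.
  rewrite !(powRN _ (- a)) lef_pV2 ?posrE ?powR_gt0 //.
  by apply: ge0_ler_powR; rewrite ?nnegrE ?oppr_ge0 //; exact: ltW.
apply: (@dense_of_blocks _ _ (fun m => (2 ^ k * m).+1) b) => //.
- by move=> m n mn; rewrite ltnS leq_mul2l mn orbT.
- move=> m; rewrite mulnS addnC -addSn /b.
  have bm := signed_interval_dyadic_diff k d (2 ^ k * m).+1.
  have [D0|D0] := leP 0 (dyadic_diff k d (2 ^ k * m).+1%:R).
    by rewrite ger0_norm.
  by rewrite ltr0_norm //; exact: signed_interval_sumN.
- by move=> m; exact: normr_ge0.
- apply: (@squeeze_cvgr _ _ _ _ (fun=> 0) (fun m => `|C| * m.+1%:R `^ a)).
  + by apply: nearW => m; rewrite normr_ge0; case/andP: (bounds m).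
  + exact: cvg_cst.
  + by rewrite -(mulr0 `|C|); apply: cvgMr; exact: powR_seq_cvg0.
move=> bcvg; apply: (@dvg_harmonic R).
have c0 : 0 < `|C| / 2 ^+ k.+1 by rewrite divr_gt0 ?exprn_gt0.
apply: (@series_le_cvg _ _ ((`|C| / 2 ^+ k.+1)^-1 *: b)).
- by move=> m; exact: harmonic_ge0.
- by move=> m; apply: mulr_ge0; [rewrite invr_ge0 ltW|exact: normr_ge0].
- move=> m; rewrite -[X in X <= _](mulKf (lt0r_neq0 c0)).
  by rewrite ler_pM2l ?invr_gt0 //; case/andP: (bounds m).
exact: is_cvg_seriesZ.
Qed.

(** * The exponents for which density fails *)

(** Cauchy condensation: with r = 2^(1+d) < 1, S(N) <= S(2N+1) <= 1 + r * S(N), whence S(N) <=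
    1/(1-r). *)
Lemma powR_sum_bounded (R : realType) (d : R) : d < -1 ->
  exists B : R, forall N, \sum_(0 <= n < N) n.+1%:R `^ d <= B.
Proof.
move=> d1; pose S N := \sum_(0 <= n < N) n.+1%:R `^ d.
pose r : R := 2 * 2 `^ d.
have r1 : r < 1.
  rewrite /r -[X in X * _]powRr1 // -powRD ?pnatr_eq0 ?implybT //.
  have -> : 1 + d = - (- 1 - d) by ring.
  rewrite powRN invf_lt1 ?powR_gt0 //.
  have : 1 `^ (- 1 - d) < 2 `^ (- 1 - d) :> R.
    by apply: gt0_ltr_powR; rewrite ?nnegrE //; lra.
  by rewrite powR1.
(* Pairing the terms at 2j and 2j+1, each at most 2^d * j^d. *)
have SD N : S (2 * N).+1 <= 1 + r * S N.
  elim: N => [|N IH].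
    by rewrite /S muln0 big_nat1 big_geq // mulr0 addr0 powR1.
  rewrite mulnS addnC /S addn2 !big_nat_recr //= mulrDr.
  have : (2 * N).+3%:R `^ d <= (2 * N).+2%:R `^ d :> R.
    have -> : d = - (- d) by rewrite opprK.
    rewrite !(powRN _ (- d)) lef_pV2 ?posrE ?powR_gt0 //.
    by apply: ge0_ler_powR; rewrite ?nnegrE ?ler_nat //; lra.
  have -> : (2 * N).+2%:R `^ d = 2 `^ d * N.+1%:R `^ d :> R.
    by rewrite -powRM // -natrM mulnS.
  move: IH; rewrite /S /= big_nat_recr //= /r.
  set s := bigop _ _ _; set s' := bigop _ _ _.
  set u := _.+3%:R `^ d; set v := N.+1%:R `^ d; set w := 2 `^ d.
  set z := (2 * N).+1%:R `^ d.
  lra.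
exists (1 - r)^-1 => N.
rewrite -[leRHS]mul1r ler_pdivlMr ?subr_gt0 //.
suff : S N <= 1 + r * S N by rewrite /S; lra.
apply: le_trans (SD N).
rewrite /S [leRHS](@big_cat_nat _ _ _ N) //=; last by lia.
by rewrite lerDl; apply: sumr_ge0 => n _; exact: powR_ge0.
Qed.

Lemma signed_sums_powR_bounded (R : realType) (d : R) : d < -1 ->
  exists B : R, forall x,
    signed_sums [set n : nat | (0 < n)%N] (fun n : nat => n%:R `^ d) x ->
    `|x| <= B.
Proof.
move=> /powR_sum_bounded[B SB]; exists B => x [S [eps [Spos epsE ->]]].
(* All indices of [S] lie in 1..N, so the absolute values are dominated by the full sum up to
   [N]. *)
pose N := (\max_(n <- S) n)%N.
apply: le_trans (SB N).
apply: le_trans (ler_norm_sum _ _ _) _.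
have -> : \sum_(n <- S) `|eps n * n%:R `^ d| = \sum_(n <- S) n%:R `^ d.
  apply: eq_big_seq => n nS; rewrite normrM (ger0_norm (powR_ge0 _ _)).
  by case: (epsE n nS) => ->; rewrite ?normrN normr1 mul1r.
have -> : \sum_(n <- S) n%:R `^ d =
    \sum_(n <- [seq n <- index_iota 1 N.+1 | n \in S]) n%:R `^ d.
  apply: perm_big; apply: uniq_perm; rewrite ?filter_uniq ?iota_uniq //.
  move=> n; rewrite mem_filter mem_index_iota.
  case: (boolP (n \in S)) => //= nS.
  by rewrite Spos //= ltnS; apply/esym; exact: leq_bigmax_seq.
rewrite big_filter big_mkcond big_add1 /=.
by apply: ler_sum => n _; case: ifP => // _; exact: powR_ge0.
Qed.

Lemma signed_sums_int (R : realType) (T : choiceType) (I : set T)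
    (A : T -> R) :
  (forall n, A n \is a Num.int) ->
  signed_sums I A `<=` [set x | x \is a Num.int].
Proof.
move=> Aint x [S [eps [_ epsE ->]]] /=.
rewrite big_seq; apply: rpred_sum => n nS.
by case: (epsE n nS) => ->; rewrite ?mulN1r ?mul1r ?rpredN.
Qed.

Theorem theorem5 (R : realType) (delta : R) :
  dense_expandable [set n : nat | (0 < n)%N] (fun n : nat => n%:R `^ delta) <->
  delta = -1 \/ (-1 < delta /\ delta \isn't a Num.int).
Proof.
split.
  move=> dense_delta.
  have [delta_lt|delta_gt|->] := ltgtP delta (-1); last by left.
    have [B SB] := signed_sums_powR_bounded delta_lt.
    have [||x /= [xB /SB]] := dense_delta [set x | B < x].
    - by exists (B + 1); rewrite /= ltrDl.
    - exact: open_gt.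
    - by move=> /(le_trans (ler_norm x)); rewrite leNgt xB.
  right; split=> //; apply/negP => delta_int.
  (* As delta > -1, its ceiling is nonnegative, so an integer delta is a natural number [k]; all n^k
     are then integers and the sums miss the interval ]0, 1[. *)
  move: delta_gt delta_int; rewrite -ceil_ge0 intrEceil.
  case: (Num.ceil delta) => // k _ /eqP deltaE.
  have [||x [/= x01 /signed_sums_int xint]] := dense_delta `]0, 1[%classic.
  - by exists (2^-1); rewrite /= in_itv /=; lra.
  - exact: itv_open.
  have {}xint : x \is a Num.int.
    apply: xint => n; rewrite -deltaE -pmulrn powR_mulrn //.
    by rewrite rpredX // rpred_nat.
  move: x01; case/intrP: xint => z ->; rewrite in_itv /= ltr0z ltrz1; lia.
case=> [->|[delta_gt delta_nint]].
  apply: (@dense_expandable_powR _ 0) => /=; first exact: oner_neq0.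
  by rewrite subr0 lexx ltrN10.
have /andP[] := ceil_itv delta.
move: delta_gt (delta_nint); rewrite -ceil_ge0 intrEceil.
case: (Num.ceil delta) => // k _ kN kgt kge.
apply: (@dense_expandable_powR _ k); first exact: dyadic_coef_neq0.
(* Non-integrality makes the ceiling bound strict, so the exponent delta - k is negative. *)
have klt : delta < k%:R by rewrite lt_neqAle kge andbT eq_sym.
by move: kgt; rewrite intrB -pmulrn; lra.
Qed.
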